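(* Let $\alpha_0,\alpha_1,\alpha_2$ be complex parameters with $\alpha_0+2\alpha_1+2\alpha_2=1$, and consider the Hamiltonian system $$\frac{dx}{dt}=\frac{\partial H}{\partial y},\quad \frac{dy}{dt}=-\frac{\partial H}{\partial x},\quad \frac{dz}{dt}=\frac{\partial H}{\partial w},\quad \frac{dw}{dt}=-\frac{\partial H}{\partial z}$$ with $$H=2xy^2+2x^2+2tx-2\alpha_1 y+z^2w-\frac{w^2}{2}+\alpha_0 z+xw+2yzw .$$ This system admits the affine Weyl group of type $A_4^{(2)}$ as a group of Bäcklund transformations, whose generators $s_0,s_1,s_2$ are defined as follows: with $( * ):=(x,y,z,w,t;\alpha_0,\alpha_1,\alpha_2)$ and $f_2:=x+y^2+w+t$, $$s_0:( * )\mapsto\Big(x,\;y,\;z+\frac{\alpha_0}{w},\;w,\;t;\;-\alpha_0,\;\alpha_1+\alpha_0,\;\alpha_2\Big),$$ $$s_1:( * )\mapsto\Big(x,\;y-\frac{\alpha_1}{x+z^2},\;z,\;w-\frac{2\alpha_1 z}{x+z^2},\;t;\;\alpha_0+2\alpha_1,\;-\alpha_1,\;\alpha_2+\alpha_1\Big),$$ $$s_2:( * )\mapsto\Big(x+\frac{2\alpha_2 y}{f_2}-\frac{\alpha_2^2}{f_2^2},\;y-\frac{\alpha_2}{f_2},\;z+\frac{\alpha_2}{f_2},\;w,\;t;\;\alpha_0,\;\alpha_1+2\alpha_2,\;-\alpha_2\Big).$$ That is, each $s_i$ is a Bäcklund transformation of the system, and $s_0,s_1,s_2$ satisfy the defining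 relations of the affine Weyl group of type $A_4^{(2)}$.
   Context: A Bäcklund transformation here is a birational transformation of the variables $(x,y,z,w)$ (with coefficients depending rationally on $t$ and the parameters), together with a map on the parameters, such that if $(x,y,z,w)$ satisfies the system with parameters $(\alpha_0,\alpha_1,\alpha_2)$ then the transformed variables satisfy the same system with the transformed parameters. The $s_i$ are composed as automorphisms of the field of rational functions in $x,y,z,w,t,\alpha_0,\alpha_1,\alpha_2$ (modulo $\alpha_0+2\alpha_1+2\alpha_2=1$). The affine Weyl group of type $A_4^{(2)}$ is the Coxeter group $$\langle s_0,s_1,s_2\mid s_0^2=s_1^2=s_2^2=(s_0s_2)^2=(s_0s_1)^4=(s_1s_2)^4=1\rangle .$$ *)

(* Defs.v *)
From HB Require Import structures.
From mathcomp Require Import all_boot all_order all_algebra.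
From mathcomp Require Import generic_quotient.
From mathcomp Require Import boolp classical_sets topology normedtype derive.
(* mpoly's notations clash with those of MathComp-Analysis. *)
From mathcomp.multinomials Require Import -(notations) mpoly.

Set Implicit Arguments.
Unset Strict Implicit.
Unset Printing Implicit Defensive.

Import Order.TTheory GRing.Theory Num.Theory.
Import numFieldNormedType.Exports.
Local Open Scope classical_set_scope.
Local Open Scope ring_scope.

Section A42.
(* To be instantiated with the field R[i] of complex numbers. *)
Variable C : numFieldType.

Record params := Params { alpha0 : C; alpha1 : C; alpha2 : C }.

Definition normalized (a : params) : Prop :=
  alpha0 a + 2 * alpha1 a + 2 * alpha2 a = 1.

(* The Hamiltonian is a polynomial in (x, y, z, w, t), in this order. *)
Definition ix : 'I_5 := @Ordinal 5 0 isT.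
Definition iy : 'I_5 := @Ordinal 5 1 isT.
Definition iz : 'I_5 := @Ordinal 5 2 isT.
Definition iw : 'I_5 := @Ordinal 5 3 isT.
Definition it : 'I_5 := @Ordinal 5 4 isT.

Definition hamiltonian (a : params) : mpoly 5 C :=
  let x := mpolyX C (mnm1 ix) in let y := mpolyX C (mnm1 iy) in
  let z := mpolyX C (mnm1 iz) in let w := mpolyX C (mnm1 iw) in
  let t := mpolyX C (mnm1 it) in
  2 * x * y ^+ 2 + 2 * x ^+ 2 + 2 * t * x - (2 * alpha1 a) *: y
  + z ^+ 2 * w - 2^-1 *: w ^+ 2 + alpha0 a *: z + x * w + 2 * y * z * w.

(* C is normed over itself: these are derivatives in the complex variable t. *)
Definition solves (a : params) (U : set C) (x y z w : C -> C) : Prop :=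
  forall t : C, U t ->
    let v := tnth [tuple x t; y t; z t; w t; t] in
    let dH i := meval v (mderiv i (hamiltonian a)) in
    [/\ is_derive (t : C^o) 1 (x : C^o -> C^o) (dH iy),
        is_derive (t : C^o) 1 (y : C^o -> C^o) (- dH ix),
        is_derive (t : C^o) 1 (z : C^o -> C^o) (dH iw) &
        is_derive (t : C^o) 1 (w : C^o -> C^o) (- dH iz)].

(* The field of rational functions in x, y, z, w, t, alpha_0, alpha_1, alpha_2
   modulo alpha_0 + 2 alpha_1 + 2 alpha_2 = 1: the relation is used to eliminate
   alpha_0, so the seven variables are (x, y, z, w, t, alpha_1, alpha_2). *)
Definition ratfun := {fraction (mpoly 7 C)}.

Definition rconst (c : C) : ratfun := tofrac (mpolyC 7 c).
Definition rvar (k : 'I_7) : ratfun := tofrac (mpolyX C (mnm1 k)).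

Definition rx : ratfun := rvar (@Ordinal 7 0 isT).
Definition ry : ratfun := rvar (@Ordinal 7 1 isT).
Definition rz : ratfun := rvar (@Ordinal 7 2 isT).
Definition rw : ratfun := rvar (@Ordinal 7 3 isT).
Definition rt : ratfun := rvar (@Ordinal 7 4 isT).
Definition ra1 : ratfun := rvar (@Ordinal 7 5 isT).
Definition ra2 : ratfun := rvar (@Ordinal 7 6 isT).
Definition ra0 : ratfun := 1 - 2 * ra1 - 2 * ra2.

Definition point (x y z w t : C) (a : params) : 'I_7 -> C :=
  tnth [tuple x; y; z; w; t; alpha1 a; alpha2 a].

(* r is regular at the point v, with value c there. *)
Definition has_value (r : ratfun) (v : 'I_7 -> C) (c : C) : Prop :=
  exists n d : mpoly 7 C,
    [/\ r = tofrac n / tofrac d, meval v d != 0 & c = meval v n / meval v d].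

(* Substitution of e k for the k-th variable.  It is the unique C-algebra
   endomorphism with these values when the e k are algebraically independent;
   otherwise it depends on the chosen representative and may divide by zero. *)
Definition rsubst (e : 'I_7 -> ratfun) (r : ratfun) : ratfun :=
  mmap rconst e (frac (repr r)).1 / mmap rconst e (frac (repr r)).2.

(* An automorphism s of the field of rational functions, together with the
   map p on the parameters.  The last clause speaks of holomorphic solutions on
   an open set on which the transformed variables have no poles. *)
Record is_backlund (s : ratfun -> ratfun) (p : params -> params) : Prop :=
  IsBacklund {
    backlund_additive : zmod_morphism s;
    backlund_multiplicative : monoid_morphism s;
    backlund_bijective : bijective s;
    backlund_const : forall c, s (rconst c) = rconst c;
    backlund_time : s rt = rt;
    backlund_normalized : forall a, normalized a -> normalized (p a);
    backlund_params : forall a x y z w t, normalized a ->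
      let v := point x y z w t a in
      [/\ has_value (s ra0) v (alpha0 (p a)),
          has_value (s ra1) v (alpha1 (p a)) &
          has_value (s ra2) v (alpha2 (p a))];
    backlund_solutions :
      forall (a : params) (U : set C) (x y z w x' y' z' w' : C -> C),
        normalized a -> open (U : set C^o) -> solves a U x y z w ->
        (forall t, U t ->
           let v := point (x t) (y t) (z t) (w t) t a in
           [/\ has_value (s rx) v (x' t), has_value (s ry) v (y' t),
               has_value (s rz) v (z' t) & has_value (s rw) v (w' t)]) ->
        solves (p a) U x' y' z' w'
  }.

Definition s0 : ratfun -> ratfun :=
  rsubst (tnth [tuple rx; ry; rz + ra0 / rw; rw; rt; ra1 + ra0; ra2]).
Definition p0 (a : params) : params :=
  Params (- alpha0 a) (alpha1 a + alpha0 a) (alpha2 a).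

Definition s1 : ratfun -> ratfun :=
  rsubst (tnth [tuple rx; ry - ra1 / (rx + rz ^+ 2); rz;
                      rw - 2 * ra1 * rz / (rx + rz ^+ 2); rt;
                      - ra1; ra2 + ra1]).
Definition p1 (a : params) : params :=
  Params (alpha0 a + 2 * alpha1 a) (- alpha1 a) (alpha2 a + alpha1 a).

Definition f2 : ratfun := rx + ry ^+ 2 + rw + rt.
Definition s2 : ratfun -> ratfun :=
  rsubst (tnth [tuple rx + 2 * ra2 * ry / f2 - ra2 ^+ 2 / f2 ^+ 2;
                      ry - ra2 / f2; rz + ra2 / f2; rw; rt;
                      ra1 + 2 * ra2; - ra2]).
Definition p2 (a : params) : params :=
  Params (alpha0 a) (alpha1 a + 2 * alpha2 a) (- alpha2 a).

End A42.

(* The defining relations of the affine Weyl group of type A_4^(2). *)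
Record weyl_A42_relations (T : Type) (g0 g1 g2 : T -> T) : Prop :=
  WeylA42Relations {
    weyl_g0g0 : iter 2 g0 =1 id;
    weyl_g1g1 : iter 2 g1 =1 id;
    weyl_g2g2 : iter 2 g2 =1 id;
    weyl_g0g2 : iter 2 (g0 \o g2) =1 id;
    weyl_g0g1 : iter 4 (g0 \o g1) =1 id;
    weyl_g1g2 : iter 4 (g1 \o g2) =1 id
  }.

(* Main.v *)
(* Each s_i substitutes e_k = n_k / d for the variables, and this substitution
   is formally an involution: d(e) = d and n_k(e) = X_k d.  Clearing
   denominators in a relation p(e) = 0 gives a polynomial q = 0 with
   q(e) = d(e)^m p(X), so p = 0: the e_k are algebraically independent and the
   substitution extends to an involutive automorphism of the field.

   With f_1 = x + z^2 and f_2 = x + y^2 + w + t, the pairs (s_0, s_1) and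
   (s_1, s_2) act in the same way, on (w, f_1, -z, y) and on
   (f_1, f_2, y + z, -z) respectively, so the two relations of order four are
   instances of one braid relation.

   A pole of s_i along {d = 0} really is a pole of some transformed variable, at
   every point of {d = 0}: substituting a parametrization of the hypersurface
   into a fraction n / d' equal to it shows that d' vanishes there.  Hence the
   transformed functions are given by the explicit formulas, which are
   differentiated directly. *)
Require Import Defs.
From HB Require Import structures.
From mathcomp Require Import all_boot all_order all_algebra complex reals.
From mathcomp Require Import generic_quotient ring.
From mathcomp Require Import boolp classical_sets topology normedtype derive.
From mathcomp.multinomials Require Import -(notations) mpoly.

Set Implicit Arguments.
Unset Strict Implicit.
Unset Printing Implicit Defensive.

Import Order.TTheory GRing.Theory Num.Theory.
Import numFieldNormedType.Exports.
Local Open Scope classical_set_scope.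
Local Open Scope ring_scope.

(** * Substitution in rational functions *)

Section Substitution.
Variable C : numFieldType.
Local Notation K := (ratfun C).
Local Notation P := (mpoly 7 C).
Local Notation X k := (mpolyX C (mnm1 k)).
Local Notation F := (@tofrac P).

HB.instance Definition _ :=
  GRing.RMorphism.copy (@rconst C) (@tofrac P \o @mpolyC 7 C).

(** [rsubst] works on the chosen representative [repr r]; this links that choice to division in the
    field. *)
Lemma ratfunE (r : K) :
  F (frac (repr r)).1 / F (frac (repr r)).2 = r.
Proof.
rewrite -[RHS]reprK; move: (repr r) => q.
have d0 : F (frac q).2 != 0 by rewrite tofrac_eq0 denom_ratioP.
apply: (mulIf d0); rewrite divfK //.
unlock FracField.tofrac; rewrite -[RHS]FracField.pi_mul; apply/eqmodP => /=.
rewrite /FracField.equivf /FracField.mulf /=.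
by rewrite !numden_Ratio ?oner_eq0 ?mulr1 ?mul1r ?denom_ratioP.
Qed.

Lemma mmapXU (e : 'I_7 -> K) k : mmap (@rconst C) e (X k) = e k.
Proof. by rewrite mmapX mmap1U. Qed.

Lemma mmap_rvar (p : P) : mmap (@rconst C) (@rvar C) p = F p.
Proof.
elim/mpolyind: p => [|c m p _ _ IH]; first by rewrite !rmorph0.
rewrite mmapD IH [RHS]rmorphD; congr (_ + _).
rewrite mmapZ mmapX -mul_mpolyC rmorphM /=; congr (_ * _).
rewrite mpolyXE_id rmorph_prod; apply: eq_bigr => i _.
by rewrite rmorphXn.
Qed.

Definition alg_indep (e : 'I_7 -> K) :=
  forall p : P, mmap (@rconst C) e p = 0 -> p = 0.

(** The quantifier order matters: one [m] and one [q] serve every [u], so the identity can be read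
    both at the variables and at their images. *)
Lemma clear_denominators (N : 'I_7 -> P) (D p : P) :
  exists m (q : P), forall u : 'I_7 -> K, mmap (@rconst C) u D != 0 ->
    mmap (@rconst C) u q = mmap (@rconst C) u D ^+ m *
      mmap (@rconst C)
        (fun k => mmap (@rconst C) u (N k) / mmap (@rconst C) u D) p.
Proof.
elim/mpolyind: p => [|c mm p _ _ [m1 [q1 H1]]].
  by exists 0%N, 0 => u _; rewrite !rmorph0 mulr0.
have [m2 [q2 H2]] : exists m (q : P), forall u : 'I_7 -> K,
    mmap (@rconst C) u D != 0 ->
    mmap (@rconst C) u q = mmap (@rconst C) u D ^+ m *
    mmap1 (fun k => mmap (@rconst C) u (N k) / mmap (@rconst C) u D) mm.
  (* A monomial absorbs one factor [D] per variable, counted with multiplicity, hence the total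
     degree. *)
  exists (\sum_i mm i)%N, (\prod_i N i ^+ mm i) => u Du.
  rewrite rmorph_prod /= /mmap1 -prodrXr -big_split /=; apply: eq_bigr => i _.
  by rewrite rmorphXn /= -exprMn mulrC divfK.
(* The exponents add up, and each summand is multiplied by the power of [D] that the other one
   used. *)
exists (m1 + m2)%N, (c *: q2 * D ^+ m1 + D ^+ m2 * q1) => u Du.
rewrite [LHS]rmorphD [in RHS]rmorphD /= !rmorphM /= !mmapZ mmapX !rmorphXn /=.
rewrite H1 // H2 // exprD; ring.
Qed.

Lemma alg_indep_of_inverse (e : 'I_7 -> K) (N : 'I_7 -> P) (D : P) :
  D != 0 -> mmap (@rconst C) e D != 0 ->
  (forall k, e k = F (N k) / F D) ->
  (forall k, mmap (@rconst C) e (N k) = rvar C k * mmap (@rconst C) e D) ->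
  alg_indep e.
Proof.
move=> D0 eD0 eE eN p p0.
have [m [q Hq]] := clear_denominators N D p.
(* First reading, at the variables: [q] becomes [D ^+ m] times the relation assumed at [e]. *)
have q0 : q = 0.
  apply/eqP; rewrite -tofrac_eq0 -mmap_rvar Hq mmap_rvar ?tofrac_eq0 //.
  have -> : (fun k => mmap (@rconst C) (@rvar C) (N k) / F D) = e.
    by apply/funext => k; rewrite mmap_rvar eE.
  by rewrite p0 mulr0.
apply/eqP; rewrite -tofrac_eq0 -mmap_rvar; apply/eqP.
(* Second reading, at [e]: each quotient becomes the k-th variable, leaving [p] itself times a
   nonzero power. *)
have := Hq e eD0; rewrite q0 rmorph0 => /esym/eqP.
rewrite mulf_eq0 expf_eq0 (negbTE eD0) andbF /=.
suff -> : (fun k => mmap (@rconst C) e (N k) / mmap (@rconst C) e D) =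
          @rvar C by move/eqP.
by apply/funext => k; rewrite eN mulfK.
Qed.

(** Algebraic independence keeps nonzero denominators nonzero, so the cross-multiplied equality
    between [n / d] and the chosen representative survives substitution. *)
Lemma rsubst_div (e : 'I_7 -> K) (n d : P) : alg_indep e -> d != 0 ->
  rsubst e (F n / F d) =
  mmap (@rconst C) e n / mmap (@rconst C) e d.
Proof.
move=> fe d0; rewrite /rsubst.
set r := repr _.
have r2 : (frac r).2 != 0 by exact: denom_ratioP.
have phi0 p : p != 0 -> mmap (@rconst C) e p != 0.
  by apply: contraNneq => /fe ->.
have /eqP := ratfunE (F n / F d); rewrite -/r.
rewrite eqr_div ?tofrac_eq0 // -!rmorphM /= tofrac_eq => /eqP E.
by apply/eqP; rewrite eqr_div ?phi0 // -!rmorphM /= E.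
Qed.

Lemma rsubst_tofrac e p : alg_indep e -> rsubst e (F p) = mmap (@rconst C) e p.
Proof.
move=> fe; have := rsubst_div p fe (oner_neq0 _).
by rewrite !rmorph1 !divr1.
Qed.

Lemma rsubst_zmod_morphism e : alg_indep e -> zmod_morphism (rsubst e).
Proof.
move=> fe r s; rewrite -[r]ratfunE -[s]ratfunE.
set n := (frac _).1; set d := (frac _).2.
set n' := (frac _).1; set d' := (frac _).2.
have d0 : d != 0 by exact: denom_ratioP.
have d0' : d' != 0 by exact: denom_ratioP.
have phi0 p : p != 0 -> mmap (@rconst C) e p != 0.
  by apply: contraNneq => /fe ->.
have -> : F n / F d - F n' / F d' = F (n * d' - n' * d) / F (d * d').
  rewrite -mulNr addf_div ?tofrac_eq0 // mulNr.
  by rewrite [F (_ - _)]rmorphB; congr (_ / _); rewrite !rmorphM.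
rewrite !rsubst_div ?mulf_neq0 // mmapB !rmorphM /=.
by rewrite -[in RHS]mulNr addf_div ?phi0 // mulNr.
Qed.

Lemma rsubst_monoid_morphism e : alg_indep e -> monoid_morphism (rsubst e).
Proof.
move=> fe; split.
  by rewrite -(tofrac1 P) rsubst_tofrac // rmorph1.
move=> r s; rewrite -[r]ratfunE -[s]ratfunE.
set n := (frac _).1; set d := (frac _).2.
set n' := (frac _).1; set d' := (frac _).2.
have d0 : d != 0 by exact: denom_ratioP.
have d0' : d' != 0 by exact: denom_ratioP.
by rewrite mulf_div -!rmorphM !rsubst_div ?mulf_neq0 // !rmorphM /= mulf_div.
Qed.

Lemma rsubst_rconst e c : alg_indep e -> rsubst e (rconst c) = rconst c.
Proof. by move=> fe; rewrite rsubst_tofrac // mmapC. Qed.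

Lemma rsubst_rvar e k : alg_indep e -> rsubst e (rvar C k) = e k.
Proof. by move=> fe; rewrite rsubst_tofrac // mmapXU. Qed.

(** Reduces the identities between automorphisms below to the constants and the seven variables. *)
Lemma ratfun_morphism_ext (f g : {rmorphism K -> K}) :
  (forall c, f (rconst c) = g (rconst c)) ->
  (forall k, f (rvar C k) = g (rvar C k)) -> f =1 g.
Proof.
move=> fgC fgX.
have fgP p : f (F p) = g (F p).
  elim/mpolyind: p => [|c m p _ _ IH]; first by rewrite !rmorph0.
  rewrite !rmorphD IH; congr (_ + _).
  rewrite -mul_mpolyC !rmorphM /= fgC; congr (_ * _).
  rewrite mpolyXE_id !rmorph_prod; apply: eq_bigr => i _.
  by rewrite !rmorphXn fgX.
by move=> r; rewrite -[r]ratfunE !fmorph_div !fgP.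
Qed.

End Substitution.

(** * The three substitutions *)

Local Notation o k := (@Ordinal 7 k isT).

Lemma forall_ord7 (Q : 'I_7 -> Prop) :
  Q (o 0) -> Q (o 1) -> Q (o 2) -> Q (o 3) -> Q (o 4) -> Q (o 5) -> Q (o 6) ->
  forall k, Q k.
Proof.
by move=> q0 q1 q2 q3 q4 q5 q6 [[|[|[|[|[|[|[|//]]]]]]] i];
  rewrite (_ : i = isT) //; apply: bool_irrelevance.
Qed.

(* The images of the variables under s_i are num_i / den_i.  Stated over any
   ring, these formulas serve for polynomials, rational functions and complex
   numbers alike. *)
Section CommonDenominator.
Variables (A : comNzRingType) (v : 'I_7 -> A).
Let x := v (o 0). Let y := v (o 1). Let z := v (o 2). Let w := v (o 3).
Let t := v (o 4). Let a1 := v (o 5). Let a2 := v (o 6).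

Definition a0_of : A := 1 - 2 * a1 - 2 * a2.

Definition den0 : A := w.
Definition num0 : 'I_7 -> A :=
  tnth [tuple x * w; y * w; z * w + a0_of; w * w; t * w; (a1 + a0_of) * w;
              a2 * w].

Definition den1 : A := x + z ^+ 2.
Definition num1 : 'I_7 -> A :=
  tnth [tuple x * den1; y * den1 - a1; z * den1; w * den1 - 2 * a1 * z;
              t * den1; - a1 * den1; (a2 + a1) * den1].

Definition f2_of : A := x + y ^+ 2 + w + t.
(** The image of x has a double pole, so the common denominator is a square and the other numerators
    carry spare factors. *)
Definition den2 : A := f2_of ^+ 2.
Definition num2 : 'I_7 -> A :=
  tnth [tuple x * f2_of ^+ 2 + 2 * a2 * y * f2_of - a2 ^+ 2;
              y * f2_of ^+ 2 - a2 * f2_of; z * f2_of ^+ 2 + a2 * f2_of;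
              w * f2_of ^+ 2; t * f2_of ^+ 2; (a1 + 2 * a2) * f2_of ^+ 2;
              - a2 * f2_of ^+ 2].
End CommonDenominator.

Section Images.
Variables (L : fieldType) (v : 'I_7 -> L).
Let x := v (o 0). Let y := v (o 1). Let z := v (o 2). Let w := v (o 3).
Let t := v (o 4). Let a1 := v (o 5). Let a2 := v (o 6).

(** The formulas of [s0], [s1], [s2] over an arbitrary field, so that rational functions and complex
    values share the same identities. *)
Definition img0 : 'I_7 -> L :=
  tnth [tuple x; y; z + a0_of v / w; w; t; a1 + a0_of v; a2].
Definition img1 : 'I_7 -> L :=
  tnth [tuple x; y - a1 / (x + z ^+ 2); z; w - 2 * a1 * z / (x + z ^+ 2); t;
              - a1; a2 + a1].
Definition img2 : 'I_7 -> L :=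
  tnth [tuple x + 2 * a2 * y / f2_of v - a2 ^+ 2 / f2_of v ^+ 2;
              y - a2 / f2_of v; z + a2 / f2_of v; w; t; a1 + 2 * a2; - a2].
End Images.

Ltac vars7 := rewrite !(tnth_nth 0) /=.

Ltac gen7 v :=
  move: (v (o 0)) (v (o 1)) (v (o 2)) (v (o 3)) (v (o 4)) (v (o 5)) (v (o 6))
    => x y z w t a1 a2.

(** * Compatibility of the formulas with ring morphisms *)

Section Morphisms.
Variables (A B : comNzRingType) (f : {rmorphism A -> B}) (v : 'I_7 -> A).

Lemma rmorph_a0 : f (a0_of v) = a0_of (f \o v).
Proof. by rewrite /a0_of !(rmorphB, rmorphM, rmorph1, rmorph_nat). Qed.

Lemma rmorph_den0 : f (den0 v) = den0 (f \o v).
Proof. by []. Qed.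

Lemma rmorph_num0 k : f (num0 v k) = num0 (f \o v) k.
Proof.
move: k; apply: forall_ord7; rewrite /num0; vars7;
  by rewrite ?(rmorph_a0, rmorphD, rmorphB, rmorphM, rmorphN).
Qed.

Lemma rmorph_den1 : f (den1 v) = den1 (f \o v).
Proof. by rewrite /den1 rmorphD rmorphXn. Qed.

Lemma rmorph_num1 k : f (num1 v k) = num1 (f \o v) k.
Proof.
move: k; apply: forall_ord7; rewrite /num1; vars7;
  by rewrite ?(rmorph_den1, rmorph_nat, rmorphD, rmorphB, rmorphM, rmorphN).
Qed.

Lemma rmorph_f2 : f (f2_of v) = f2_of (f \o v).
Proof. by rewrite /f2_of !rmorphD rmorphXn. Qed.

Lemma rmorph_den2 : f (den2 v) = den2 (f \o v).
Proof. by rewrite /den2 rmorphXn /= rmorph_f2. Qed.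

Lemma rmorph_num2 k : f (num2 v k) = num2 (f \o v) k.
Proof.
move: k; apply: forall_ord7; rewrite /num2; vars7;
  by rewrite ?(rmorph_f2, rmorph_nat, rmorphD, rmorphB, rmorphM, rmorphN,
    rmorphXn).
Qed.
End Morphisms.

(** * Formal involutivity of the three substitutions *)

Section Identities.
Variables (L : fieldType) (v : 'I_7 -> L).

Lemma img0E : den0 v != 0 -> forall k, img0 v k = num0 v k / den0 v.
Proof.
rewrite /den0 => d0; apply: forall_ord7; rewrite /img0 /num0 /a0_of; vars7;
  move: d0; gen7 v => d0; by field.
Qed.

Lemma den0_img : den0 (img0 v) = den0 v.
Proof. by []. Qed.

(** The involution in cleared form: w is fixed while [a0_of] changes sign, so the two shifts of z
    cancel. *)
Lemma num0_img : den0 v != 0 -> forall k, num0 (img0 v) k = v k * den0 v.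
Proof.
rewrite /den0 => d0; apply: forall_ord7; rewrite /num0; vars7;
  rewrite /a0_of /img0;
  vars7; rewrite /a0_of; move: d0; gen7 v => d0; by field.
Qed.

Lemma img1E : den1 v != 0 -> forall k, img1 v k = num1 v k / den1 v.
Proof.
rewrite /den1 => d0; apply: forall_ord7; rewrite /img1 /num1; vars7;
  rewrite /den1;
  move: d0; gen7 v => d0; by field.
Qed.

Lemma den1_img : den1 (img1 v) = den1 v.
Proof. by []. Qed.

Lemma num1_img : den1 v != 0 -> forall k, num1 (img1 v) k = v k * den1 v.
Proof.
move=> d0; apply: forall_ord7; rewrite /num1; vars7; rewrite den1_img /img1;
  vars7;
  move: d0; rewrite /den1; gen7 v => d0; by field.
Qed.

(** The change of x is the opposite of the change of the square of y, and w and t are fixed. *)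
Lemma f2_img : f2_of v != 0 -> f2_of (img2 v) = f2_of v.
Proof.
move=> d0; rewrite {1}/f2_of /img2; vars7; move: d0; rewrite /f2_of.
gen7 v => d0; by field.
Qed.

Lemma img2E : f2_of v != 0 -> forall k, img2 v k = num2 v k / den2 v.
Proof.
move=> d0; apply: forall_ord7; rewrite /img2 /num2; vars7;
  rewrite /den2; move: d0; move: (f2_of v) => f; gen7 v => d0; by field.
Qed.

Lemma den2_img : f2_of v != 0 -> den2 (img2 v) = den2 v.
Proof. by move=> d0; rewrite /den2 f2_img. Qed.

Lemma num2_img : f2_of v != 0 -> forall k, num2 (img2 v) k = v k * den2 v.
Proof.
move=> d0; apply: forall_ord7; rewrite /num2; vars7;
  rewrite f2_img // /den2 /img2;
  vars7; move: d0; move: (f2_of v) => f; gen7 v => d0; by field.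
Qed.
End Identities.

Section FieldMorphisms.
Variables (L : fieldType) (f : {rmorphism L -> L}) (v : 'I_7 -> L).

Lemma fmorph_img0 k : f (img0 v k) = img0 (f \o v) k.
Proof.
move: k; apply: forall_ord7; rewrite /img0; vars7;
  rewrite // ?(rmorph_a0, rmorphD, fmorph_div) //.
Qed.

Lemma fmorph_img1 k : f (img1 v k) = img1 (f \o v) k.
Proof.
by move: k; apply: forall_ord7; rewrite /img1; vars7;
  rewrite // ?(rmorph_nat, rmorphD, rmorphB, rmorphN, fmorph_div, rmorphXn,
    rmorphM).
Qed.

Lemma fmorph_img2 k : f (img2 v k) = img2 (f \o v) k.
Proof.
by move: k; apply: forall_ord7; rewrite /img2; vars7;
  rewrite // ?(rmorph_f2, rmorph_nat, rmorphD, rmorphB, rmorphN, fmorphV,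
    rmorphXn, rmorphM).
Qed.
End FieldMorphisms.

(** * The braid relation *)

Section Dihedral.
Variables (L : fieldType) (S1 S2 : {rmorphism L -> L}).
Variables (f1 f2 u p a1 a2 : L).
Hypotheses (f1_neq0 : f1 != 0) (f2_neq0 : f2 != 0).
Hypotheses (S1f1 : S1 f1 = f1)
  (S1f2 : S1 f2 = f2 - 2 * a1 * u / f1 + a1 ^+ 2 / f1 ^+ 2)
  (S1u : S1 u = u - a1 / f1) (S1p : S1 p = p)
  (S1a1 : S1 a1 = - a1) (S1a2 : S1 a2 = a2 + a1).
Hypotheses (S2f1 : S2 f1 = f1 + 2 * a2 * u / f2) (S2f2 : S2 f2 = f2)
  (S2u : S2 u = u) (S2p : S2 p = p - a2 / f2)
  (S2a1 : S2 a1 = a1 + 2 * a2) (S2a2 : S2 a2 = - a2).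

(** For involutions, asking this of all [r] amounts to [S1 \o S2] having trivial fourth power. *)
Definition braided r := S1 (S2 (S1 (S2 r))) = S2 (S1 (S2 (S1 r))).

(** With the next two lemmas, the braided elements are closed under the ring operations, so testing
    generators is enough. *)
Lemma braidedD r s : braided r -> braided s -> braided (r + s).
Proof. by rewrite /braided !rmorphD /= => -> ->. Qed.

Lemma braidedN r : braided r -> braided (- r).
Proof. by rewrite /braided !rmorphN /= => ->. Qed.

Lemma braidedM r s : braided r -> braided s -> braided (r * s).
Proof. by rewrite /braided !rmorphM /= => -> ->. Qed.

(* Up to powers of f1 and f2, these are the numerators of the translates of f1
   and f2: tau = f2 * S2 f1, sigma = f1 ^+ 2 * S1 f2, kappa = f1 * S1 tau and
   lambda = f2 * S2 sigma.  S1 and S2 act on them by monomial formulas. *)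
Let b := a1 + 2 * a2.
Let c := a1 + a2.
Let tau := f1 * f2 + 2 * a2 * u.
Let sigma := f1 ^+ 2 * f2 - 2 * a1 * u * f1 + a1 ^+ 2.
Let kappa := f1 * tau - a1 * b.
Let lambda := tau ^+ 2 - 2 * b * u * tau + b ^+ 2 * f2.

Let S1b : S1 b = b.
Proof. rewrite /b rmorphD rmorphM rmorph_nat S1a1 S1a2; ring. Qed.
Let S2b : S2 b = a1.
Proof. rewrite /b rmorphD rmorphM rmorph_nat S2a1 S2a2; ring. Qed.
Let S1c : S1 c = a2.
Proof. rewrite /c rmorphD S1a1 S1a2; ring. Qed.
Let S2c : S2 c = c.
Proof. rewrite /c rmorphD S2a1 S2a2; ring. Qed.

Let S1f2' : S1 f2 = sigma / f1 ^+ 2.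
Proof. by rewrite S1f2 /sigma; field. Qed.
Let S2f1' : S2 f1 = tau / f2.
Proof. by rewrite S2f1 /tau; field. Qed.
Let S1tau : S1 tau = kappa / f1.
Proof.
rewrite /tau rmorphD !rmorphM rmorph_nat S1f1 S1f2 S1u S1a2 /kappa /tau /b;
  by field.
Qed.
Let S2tau : S2 tau = f1 * f2.
Proof.
rewrite /tau rmorphD !rmorphM rmorph_nat S2f1 S2f2 S2u S2a2; by field.
Qed.
Let S1sigma : S1 sigma = f1 ^+ 2 * f2.
Proof.
rewrite /sigma rmorphD rmorphB !rmorphM rmorph_nat S1f1 S1f2 S1u S1a1.
by field.
Qed.
Let S2sigma : S2 sigma = lambda / f2.
Proof.
rewrite /sigma rmorphD rmorphB !rmorphM rmorph_nat S2f1 S2f2 S2u S2a1.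
by rewrite /lambda /tau /b; field.
Qed.
Let S1kappa : S1 kappa = f1 * tau.
Proof.
rewrite /kappa rmorphB !rmorphM S1f1 S1tau S1a1 S1b /kappa; by field.
Qed.
Let S2kappa : S2 kappa = kappa.
Proof.
rewrite /kappa rmorphB !rmorphM S2f1' S2tau S2a1 S2b -/b; by field.
Qed.
Let S1lambda : S1 lambda = lambda.
Proof.
rewrite {1}/lambda rmorphD rmorphB !rmorphM rmorph_nat S1tau S1f2 S1u S1b.
by rewrite /lambda /kappa /tau /b; field.
Qed.
Let S2lambda : S2 lambda = sigma * f2.
Proof.
rewrite {1}/lambda rmorphD rmorphB !rmorphM rmorph_nat S2tau S2f2 S2u S2b.
rewrite /sigma; by ring.
Qed.

Let S1E := (S1f1, S1f2', S1u, S1p, S1a1, S1b, S1c, S1tau, S1sigma, S1kappa,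
  S1lambda, rmorphB S1, rmorphD S1, fmorphV S1, rmorphM S1, rmorphXn S1).
Let S2E := (S2f1', S2f2, S2u, S2p, S2a1, S2b, S2c, S2tau, S2sigma, S2kappa,
  S2lambda, rmorphB S2, rmorphD S2, fmorphV S2, rmorphM S2, rmorphXn S2).

(** Field morphisms are injective, and [tau], [sigma], [kappa], [lambda] are, up to powers of [f1]
    and [f2], images of [f1], [f2], [tau], [sigma]. *)
Let tau_neq0 : tau != 0.
Proof.
have : S2 f1 != 0 by rewrite fmorph_eq0.
by rewrite S2f1'; apply: contraNneq => ->; rewrite mul0r.
Qed.
Let sigma_neq0 : sigma != 0.
Proof.
have : S1 f2 != 0 by rewrite fmorph_eq0.
by rewrite S1f2'; apply: contraNneq => ->; rewrite mul0r.
Qed.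
Let kappa_neq0 : kappa != 0.
Proof.
have : S1 tau != 0 by rewrite fmorph_eq0.
by rewrite S1tau; apply: contraNneq => ->; rewrite mul0r.
Qed.
Let lambda_neq0 : lambda != 0.
Proof.
have : S2 sigma != 0 by rewrite fmorph_eq0.
by rewrite S2sigma; apply: contraNneq => ->; rewrite mul0r.
Qed.

(** Both words send [a1] to its negative: [S2] exchanges [a1] and [b], while [S1] negates [a1] and
    fixes [b]. *)
Lemma braided_a1 : braided a1.
Proof.
by rewrite /braided S2a1 -/b S1b S2b S1a1 !rmorphN /= S2a1 -/b S1b S2b.
Qed.

Lemma braided_a2 : braided a2.
Proof.
have -> : a2 = c - a1 by rewrite /c; ring.
apply: braidedD; last exact/braidedN/braided_a1.
by rewrite /braided S2c S1c S2a2 !rmorphN /= S1a2 addrC -/c S2c.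
Qed.

(** The monomial actions lead to [kappa * tau / lambda] on both sides. *)
Lemma braided_f1 : braided f1.
Proof.
rewrite /braided S1f1 S2f1' !(S1E, S2E); field.
by rewrite f1_neq0 f2_neq0 tau_neq0 sigma_neq0 kappa_neq0 lambda_neq0.
Qed.

(** The common value is [lambda * sigma / kappa ^+ 2]. *)
Lemma braided_f2 : braided f2.
Proof.
rewrite /braided S2f2 S1f2' !(S1E, S2E); field.
by rewrite f1_neq0 f2_neq0 tau_neq0 sigma_neq0 kappa_neq0 lambda_neq0.
Qed.

Lemma braided_u : braided u.
Proof.
(* Each word adds a total shift to [u]; [E] equates the two shifts after multiplication by
   [f1 * tau * kappa]. *)
have E : tau * (a1 * kappa + b * sigma) = f1 * (b * f2 * kappa + a1 * lambda).
  by rewrite /lambda /kappa /sigma /tau /b; ring.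
rewrite /braided !(S1E, S2E) -/b; apply/eqP; rewrite -subr_eq0; apply/eqP.
transitivity ((f1 * (b * f2 * kappa + a1 * lambda) -
               tau * (a1 * kappa + b * sigma)) / (f1 * tau * kappa)).
  by field; rewrite f1_neq0 f2_neq0 tau_neq0 sigma_neq0 kappa_neq0 lambda_neq0.
by rewrite E subrr mul0r.
Qed.

Lemma braided_p : braided p.
Proof.
(* The same comparison for the shifts of [p], cleared by [f2 * lambda * sigma]. *)
have E : f2 * (c * f1 ^+ 2 * lambda + a2 * kappa ^+ 2) =
         sigma * (a2 * lambda + c * tau ^+ 2).
  by rewrite /lambda /kappa /sigma /tau /b /c; ring.
(* Folding the sum into [c] keeps every term of the shifts monomial. *)
have S1a2c : S1 a2 = c by rewrite S1a2 addrC.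
rewrite /braided !(S1a2c, S1E, S2E); apply/eqP; rewrite -subr_eq0; apply/eqP.
transitivity ((sigma * (a2 * lambda + c * tau ^+ 2) -
               f2 * (c * f1 ^+ 2 * lambda + a2 * kappa ^+ 2)) /
              (f2 * lambda * sigma)).
  by field; rewrite f1_neq0 f2_neq0 tau_neq0 sigma_neq0 kappa_neq0 lambda_neq0.
by rewrite E subrr mul0r.
Qed.

Lemma braided_generators :
  braided f1 /\ braided f2 /\ braided u /\ braided p /\ braided a1 /\
  braided a2.
Proof.
split; first exact: braided_f1; split; first exact: braided_f2.
split; first exact: braided_u; split; first exact: braided_p.
by split; [exact: braided_a1 | exact: braided_a2].
Qed.
End Dihedral.

(** * Commutation and braid relations between the substitutions *)

Section Relations.
Variables (L : fieldType) (v : 'I_7 -> L).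

Lemma a0_img0 : a0_of (img0 v) = - a0_of v.
Proof. rewrite {1}/a0_of /img0; vars7; rewrite /a0_of; by ring. Qed.

Lemma a0_img1 : a0_of (img1 v) = a0_of v + 2 * v (o 5).
Proof. rewrite {1}/a0_of /img1; vars7; rewrite /a0_of; by ring. Qed.

Lemma a0_img2 : a0_of (img2 v) = a0_of v.
Proof. rewrite {1}/a0_of /img2; vars7; rewrite /a0_of; by ring. Qed.

(** Each map leaves unchanged the data that determine the other's shifts, so on z and alpha_1, the
    only coordinates both move, the shifts commute. *)
Lemma img0_img2 : img0 (img2 v) =1 img2 (img0 v).
Proof.
have f2E : f2_of (img0 v) = f2_of v by [].
apply: forall_ord7; rewrite {1}/img0 {1}/img2; vars7; rewrite ?a0_img2 ?f2E //.
- by rewrite /img2 /img0; vars7; rewrite addrAC.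
- by rewrite /img2 /img0; vars7; rewrite addrAC.
Qed.

Variables (S0 S1 S2 : {rmorphism L -> L}).
Hypotheses (S0v : forall k, S0 (v k) = img0 v k)
  (S1v : forall k, S1 (v k) = img1 v k) (S2v : forall k, S2 (v k) = img2 v k).
Hypotheses (w_neq0 : den0 v != 0) (f1_neq0 : den1 v != 0)
  (f2_neq0 : f2_of v != 0).

(** A morphism passes through a rational formula, so composing automorphisms composes the
    substitutions in reverse order. *)
Lemma relation02 k : S0 (S2 (v k)) = S2 (S0 (v k)).
Proof.
have e0 : S0 \o v = img0 v by apply/funext.
have e2 : S2 \o v = img2 v by apply/funext.
by rewrite S0v S2v fmorph_img2 fmorph_img0 e0 e2 img0_img2.
Qed.

Let S0r : S0 (a0_of v) = - a0_of v.
Proof.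
by rewrite rmorph_a0 (_ : S0 \o v = img0 v) ?a0_img0 //; apply/funext.
Qed.
Let S1r : S1 (a0_of v) = a0_of v + 2 * v (o 5).
Proof.
by rewrite rmorph_a0 (_ : S1 \o v = img1 v) ?a0_img1 //; apply/funext.
Qed.

Lemma relation01 k : braided S0 S1 (v k).
Proof.
(* Here [a1] and [a2] of the braid section are alpha_0 and alpha_1; the sign of -z turns the shift
   of z into the form [u - a1 / f1]. *)
have [bw [bf1 [bz [by_ [br b5]]]]] : braided S0 S1 (v (o 3)) /\
  braided S0 S1 (den1 v) /\ braided S0 S1 (- v (o 2)) /\
  braided S0 S1 (v (o 1)) /\
  braided S0 S1 (a0_of v) /\ braided S0 S1 (v (o 5)).
  apply: braided_generators => //;
    rewrite /den1 ?(rmorphN, rmorphD, rmorphXn, S0v, S1v) /=;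
  rewrite ?S0r ?S1r // /img0 /img1; vars7; rewrite // -?/(den0 v) -?/(den1 v).
  - rewrite {1}/den1; move: w_neq0; rewrite /den0.
    by move: (a0_of v); gen7 v => r w0; field.
  - by rewrite opprD.
  - by rewrite mulrN mulNr.
have bz' : braided S0 S1 (v (o 2)) by rewrite -[v (o 2)]opprK; apply: braidedN.
move: k; apply: forall_ord7 => //.
- have -> : v (o 0) = den1 v - v (o 2) * v (o 2) by rewrite /den1 expr2 addrK.
  by apply: braidedD => //; apply/braidedN/braidedM.
- by rewrite /braided !(S0v (o 4), S1v (o 4)).
- have S06 : S0 (v (o 6)) = v (o 6) by exact: S0v.
  have S16 : S1 (v (o 6)) = v (o 6) + v (o 5) by exact: S1v.
  have S05 : S0 (v (o 5)) = v (o 5) + a0_of v by exact: S0v.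
  have S15 : S1 (v (o 5)) = - v (o 5) by exact: S1v.
  rewrite /braided !(S06, S16, S05, S15, S0r, S1r, rmorph_nat, rmorphN,
    rmorphD, rmorphM).
  by ring.
Qed.

Lemma relation12 k : braided S1 S2 (v k).
Proof.
(* The sum y + z serves as [u]: s_2 shifts y and z by opposite amounts and so fixes it. *)
have [bf1 [bf2 [bu [bz [b5 b6]]]]] : braided S1 S2 (den1 v) /\
  braided S1 S2 (f2_of v) /\ braided S1 S2 (v (o 1) + v (o 2)) /\
  braided S1 S2 (- v (o 2)) /\ braided S1 S2 (v (o 5)) /\
  braided S1 S2 (v (o 6)).
  apply: braided_generators => //;
  rewrite /den1 /f2_of ?(rmorphN, rmorphD, rmorphXn, S1v, S2v) /= //;
  rewrite /img1 /img2; vars7;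
  rewrite // -?/(den1 v) -?/(f2_of v).
  - rewrite /f2_of; move: f1_neq0; move: (den1 v); gen7 v => f f0; by field.
  - by rewrite addrAC.
  - rewrite /den1; move: f2_neq0; move: (f2_of v); gen7 v => f f0; by field.
  - by have := f2_img f2_neq0; rewrite {1}/f2_of /img2; vars7.
  - by rewrite addrCA addrNK addrC.
  - by rewrite opprD.
have bz' : braided S1 S2 (v (o 2)) by rewrite -[v (o 2)]opprK; apply: braidedN.
have by_ : braided S1 S2 (v (o 1)).
  by rewrite -[v (o 1)](addrK (v (o 2))); apply: braidedD.
have bx : braided S1 S2 (v (o 0)).
  have -> : v (o 0) = den1 v - v (o 2) * v (o 2) by rewrite /den1 expr2 addrK.
  by apply: braidedD => //; apply/braidedN/braidedM.
have bt : braided S1 S2 (v (o 4)) by rewrite /braided !(S1v (o 4), S2v (o 4)).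
move: k; apply: forall_ord7 => //.
have -> : v (o 3) = f2_of v - (v (o 0) + v (o 1) * v (o 1) + v (o 4)).
  by rewrite /f2_of; ring.
apply: braidedD => //; apply/braidedN/braidedD => //; apply: braidedD => //.
exact: braidedM.
Qed.
End Relations.

(** * The automorphisms s_0, s_1, s_2 *)

Section Generators.
Variable C : numFieldType.
Local Notation K := (ratfun C).
Local Notation P := (mpoly 7 C).
Local Notation F := (@tofrac P).
Local Notation X := (fun k : 'I_7 => mpolyX C (mnm1 k)).
Local Notation phi := (mmap (@rconst C)).

Lemma phiX e : phi e \o X = e.
Proof. by apply/funext => k /=; rewrite mmapXU. Qed.

Lemma tofracX : F \o X = @rvar C.
Proof. by []. Qed.

Lemma poly_eval_neq0 (v : 'I_7 -> C) (p : P) : meval v p != 0 -> p != 0.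
Proof. by apply: contraNneq => ->; rewrite meval0. Qed.

Lemma mevalXv v : meval v \o X = v.
Proof. by apply/funext => k /=; rewrite mevalXU. Qed.

Lemma denX0 : den0 X != 0.
Proof.
apply: (@poly_eval_neq0 (fun=> 1)).
by rewrite (rmorph_den0 (meval _)) mevalXv oner_neq0.
Qed.

Lemma denX1 : den1 X != 0.
Proof.
(* The value at the all-ones point is 2, nonzero in characteristic zero. *)
apply: (@poly_eval_neq0 (fun=> 1)).
by rewrite (rmorph_den1 (meval _)) mevalXv /den1 expr1n -[1]/(1%:R) -natrD
  pnatr_eq0.
Qed.

Lemma f2X : f2_of X != 0.
Proof.
apply: (@poly_eval_neq0 (fun=> 1)).
by rewrite (rmorph_f2 (meval _)) mevalXv /f2_of expr1n -[1]/(1%:R) -!natrD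
  pnatr_eq0.
Qed.

Lemma denX2 : den2 X != 0.
Proof. by rewrite /den2 expf_neq0 // f2X. Qed.

Lemma den0_rvar : den0 (@rvar C) != 0.
Proof. by rewrite -tofracX -rmorph_den0 tofrac_eq0 denX0. Qed.

Lemma den1_rvar : den1 (@rvar C) != 0.
Proof. by rewrite -tofracX -rmorph_den1 tofrac_eq0 denX1. Qed.

Lemma f2_rvar : f2_of (@rvar C) != 0.
Proof. by rewrite -tofracX -rmorph_f2 tofrac_eq0 f2X. Qed.

Lemma den2_rvar : den2 (@rvar C) != 0.
Proof. by rewrite /den2 expf_neq0 // f2_rvar. Qed.

Lemma phi_num0 e k : phi e (num0 X k) = num0 e k.
Proof.
by rewrite -[RHS](congr1 (fun v : 'I_7 -> K => num0 v k) (phiX e));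
  exact: (rmorph_num0 (phi e)).
Qed.

Lemma phi_num1 e k : phi e (num1 X k) = num1 e k.
Proof.
by rewrite -[RHS](congr1 (fun v : 'I_7 -> K => num1 v k) (phiX e));
  exact: (rmorph_num1 (phi e)).
Qed.

Lemma phi_num2 e k : phi e (num2 X k) = num2 e k.
Proof.
by rewrite -[RHS](congr1 (fun v : 'I_7 -> K => num2 v k) (phiX e));
  exact: (rmorph_num2 (phi e)).
Qed.

Lemma phi_den0 e : phi e (den0 X) = den0 e.
Proof.
by rewrite -[RHS](congr1 (@den0 K) (phiX e));
  exact: (rmorph_den0 (phi e)).
Qed.

Lemma phi_den1 e : phi e (den1 X) = den1 e.
Proof.
by rewrite -[RHS](congr1 (@den1 K) (phiX e));
  exact: (rmorph_den1 (phi e)).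
Qed.

Lemma phi_den2 e : phi e (den2 X) = den2 e.
Proof.
by rewrite -[RHS](congr1 (@den2 K) (phiX e));
  exact: (rmorph_den2 (phi e)).
Qed.

Lemma img0_rvarE k : img0 (@rvar C) k = F (num0 X k) / F (den0 X).
Proof. by rewrite rmorph_num0 rmorph_den0 tofracX img0E // den0_rvar. Qed.

Lemma img1_rvarE k : img1 (@rvar C) k = F (num1 X k) / F (den1 X).
Proof. by rewrite rmorph_num1 rmorph_den1 tofracX img1E // den1_rvar. Qed.

Lemma img2_rvarE k : img2 (@rvar C) k = F (num2 X k) / F (den2 X).
Proof. by rewrite rmorph_num2 rmorph_den2 tofracX img2E // f2_rvar. Qed.

Lemma img0_alg_indep : alg_indep (img0 (@rvar C)).
Proof.
apply: (@alg_indep_of_inverse _ _ (num0 X) (den0 X)) => [|||k].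
- exact: denX0.
- by rewrite phi_den0 den0_img den0_rvar.
- exact: img0_rvarE.
- by rewrite phi_den0 phi_num0 den0_img num0_img // den0_rvar.
Qed.

Lemma img1_alg_indep : alg_indep (img1 (@rvar C)).
Proof.
apply: (@alg_indep_of_inverse _ _ (num1 X) (den1 X)) => [|||k].
- exact: denX1.
- by rewrite phi_den1 den1_img den1_rvar.
- exact: img1_rvarE.
- by rewrite phi_den1 phi_num1 den1_img num1_img // den1_rvar.
Qed.

Lemma img2_alg_indep : alg_indep (img2 (@rvar C)).
Proof.
apply: (@alg_indep_of_inverse _ _ (num2 X) (den2 X)) => [|||k].
- exact: denX2.
- by rewrite phi_den2 (den2_img f2_rvar) den2_rvar.
- exact: img2_rvarE.
- by rewrite phi_den2 phi_num2 (den2_img f2_rvar) num2_img // f2_rvar.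
Qed.

Lemma s0E : @s0 C = rsubst (img0 (@rvar C)). Proof. by []. Qed.

Lemma s1E : @s1 C = rsubst (img1 (@rvar C)). Proof. by []. Qed.

Lemma s2E : @s2 C = rsubst (img2 (@rvar C)). Proof. by []. Qed.

HB.instance Definition _ := GRing.isZmodMorphism.Build K K (@s0 C)
  (rsubst_zmod_morphism img0_alg_indep).
HB.instance Definition _ := GRing.isMonoidMorphism.Build K K (@s0 C)
  (rsubst_monoid_morphism img0_alg_indep).
HB.instance Definition _ := GRing.isZmodMorphism.Build K K (@s1 C)
  (rsubst_zmod_morphism img1_alg_indep).
HB.instance Definition _ := GRing.isMonoidMorphism.Build K K (@s1 C)
  (rsubst_monoid_morphism img1_alg_indep).
HB.instance Definition _ := GRing.isZmodMorphism.Build K K (@s2 C)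
  (rsubst_zmod_morphism img2_alg_indep).
HB.instance Definition _ := GRing.isMonoidMorphism.Build K K (@s2 C)
  (rsubst_monoid_morphism img2_alg_indep).

Lemma s0_rvar k : s0 (rvar C k) = img0 (@rvar C) k.
Proof. by rewrite s0E rsubst_rvar //; exact: img0_alg_indep. Qed.

Lemma s1_rvar k : s1 (rvar C k) = img1 (@rvar C) k.
Proof. by rewrite s1E rsubst_rvar //; exact: img1_alg_indep. Qed.

Lemma s2_rvar k : s2 (rvar C k) = img2 (@rvar C) k.
Proof. by rewrite s2E rsubst_rvar //; exact: img2_alg_indep. Qed.

Lemma s0_rconst c : s0 (rconst c) = rconst c :> K.
Proof. by rewrite s0E rsubst_rconst //; exact: img0_alg_indep. Qed.

Lemma s1_rconst c : s1 (rconst c) = rconst c :> K.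
Proof. by rewrite s1E rsubst_rconst //; exact: img1_alg_indep. Qed.

Lemma s2_rconst c : s2 (rconst c) = rconst c :> K.
Proof. by rewrite s2E rsubst_rconst //; exact: img2_alg_indep. Qed.

Lemma s0_comp_rvar : @s0 C \o @rvar C = img0 (@rvar C).
Proof. by apply/funext => k; exact: s0_rvar. Qed.

Lemma s1_comp_rvar : @s1 C \o @rvar C = img1 (@rvar C).
Proof. by apply/funext => k; exact: s1_rvar. Qed.

Lemma s2_comp_rvar : @s2 C \o @rvar C = img2 (@rvar C).
Proof. by apply/funext => k; exact: s2_rvar. Qed.

(** On a variable, applying [s0] twice iterates [img0], and the cleared identities for [num0] and
    [den0] return the variable. *)
Lemma s0K : involutive (@s0 C).
Proof.
apply: (@ratfun_morphism_ext _ (@s0 C \o @s0 C) idfun) => [c|k] /=.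
  by rewrite !s0_rconst.
rewrite s0_rvar (fmorph_img0 (@s0 C)) s0_comp_rvar.
rewrite img0E ?den0_img ?den0_rvar //.
by rewrite num0_img ?den0_rvar // mulfK ?den0_rvar.
Qed.

Lemma s1K : involutive (@s1 C).
Proof.
apply: (@ratfun_morphism_ext _ (@s1 C \o @s1 C) idfun) => [c|k] /=.
  by rewrite !s1_rconst.
rewrite s1_rvar (fmorph_img1 (@s1 C)) s1_comp_rvar.
rewrite img1E ?den1_img ?den1_rvar //.
by rewrite num1_img ?den1_rvar // mulfK ?den1_rvar.
Qed.

Lemma s2K : involutive (@s2 C).
Proof.
apply: (@ratfun_morphism_ext _ (@s2 C \o @s2 C) idfun) => [c|k] /=.
  by rewrite !s2_rconst.
rewrite s2_rvar (fmorph_img2 (@s2 C)) s2_comp_rvar img2E ?f2_img ?f2_rvar //.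
by rewrite num2_img ?f2_rvar // den2_img ?f2_rvar // mulfK ?den2_rvar.
Qed.

Lemma s0_a0 : s0 (a0_of (@rvar C)) = - a0_of (@rvar C).
Proof. by rewrite (rmorph_a0 (@s0 C)) s0_comp_rvar a0_img0. Qed.

Lemma s1_a0 : s1 (a0_of (@rvar C)) = a0_of (@rvar C) + 2 * ra1 C.
Proof. by rewrite (rmorph_a0 (@s1 C)) s1_comp_rvar a0_img1. Qed.

Lemma s2_a0 : s2 (a0_of (@rvar C)) = a0_of (@rvar C).
Proof. by rewrite (rmorph_a0 (@s2 C)) s2_comp_rvar a0_img2. Qed.

Lemma s0s2 (r : K) : s0 (s2 r) = s2 (s0 r).
Proof.
move: r.
apply: (@ratfun_morphism_ext _ (@s0 C \o @s2 C) (@s2 C \o @s0 C)) => [c|k] /=.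
  by rewrite s2_rconst !s0_rconst s2_rconst.
exact: (relation02 s0_rvar s2_rvar).
Qed.

Lemma s0s1 (r : K) : s0 (s1 (s0 (s1 r))) = s1 (s0 (s1 (s0 r))).
Proof.
move: r; apply: (@ratfun_morphism_ext _ (@s0 C \o (@s1 C \o (@s0 C \o @s1 C)))
  (@s1 C \o (@s0 C \o (@s1 C \o @s0 C)))) => [c|k] /=.
  by rewrite !(s0_rconst, s1_rconst).
exact: (relation01 s0_rvar s1_rvar den0_rvar den1_rvar).
Qed.

Lemma s1s2 (r : K) : s1 (s2 (s1 (s2 r))) = s2 (s1 (s2 (s1 r))).
Proof.
move: r; apply: (@ratfun_morphism_ext _ (@s1 C \o (@s2 C \o (@s1 C \o @s2 C)))
  (@s2 C \o (@s1 C \o (@s2 C \o @s1 C)))) => [c|k] /=.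
  by rewrite !(s1_rconst, s2_rconst).
exact: (relation12 s1_rvar s2_rvar den1_rvar f2_rvar).
Qed.

Lemma weyl_relations : weyl_A42_relations (@s0 C) (@s1 C) (@s2 C).
Proof.
split=> r /=; rewrite ?(s0K, s1K, s2K) //.
- by rewrite s0s2 s0K s2K.
(* The braid relation reverses the outer four letters of the word of length eight; the word then
   cancels in pairs. *)
- by rewrite s0s1 !(s0K, s1K).
- by rewrite s1s2 !(s1K, s2K).
Qed.
End Generators.

(** * Values and poles *)

Section Values.
Variable C : numFieldType.
Local Notation K := (ratfun C).
Local Notation P := (mpoly 7 C).
Local Notation F := (@tofrac P).
Local Notation X := (fun k : 'I_7 => mpolyX C (mnm1 k)).
Implicit Types (v : 'I_7 -> C) (N D : P).

Lemma has_value_tofrac p v : has_value (F p) v (meval v p).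
Proof. by exists p, 1; rewrite meval1 oner_neq0 rmorph1 !divr1. Qed.

(** Two fractions for one function agree after cross-multiplication, so the identity also holds
    where [D] vanishes at [v]. *)
Lemma has_value_div N D v c :
  D != 0 -> has_value (F N / F D) v c -> c * meval v D = meval v N.
Proof.
move=> D0 [n [d [E dv ->]]].
have d0 : d != 0 by apply: contraNneq dv => ->; rewrite meval0.
move/eqP: E; rewrite eqr_div ?tofrac_eq0 // -!rmorphM /= tofrac_eq => /eqP.
move/(congr1 (meval v)); rewrite !mevalM => E.
by rewrite mulrAC -E mulfK.
Qed.

(* sigma parametrizes {D = 0}: in n * D = N * d, the left-hand side vanishes
   along sigma, hence so does d. *)
Lemma has_value_pole N D (sigma : 'I_7 -> P) v c :
  D != 0 -> mmap (@mpolyC 7 C) sigma D = 0 -> mmap (@mpolyC 7 C) sigma N != 0 ->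
  (meval v D = 0 -> forall k, meval v (sigma k) = v k) ->
  has_value (F N / F D) v c -> meval v D != 0.
Proof.
move=> D0 sD sN sv [n [d [E dv _]]]; apply/eqP => vD0.
have d0 : d != 0 by apply: contraNneq dv => ->; rewrite meval0.
move/eqP: E; rewrite eqr_div ?tofrac_eq0 // -!rmorphM /= tofrac_eq => /eqP.
move/(congr1 (mmap (@mpolyC 7 C) sigma)); rewrite !rmorphM /= sD mulr0 => /eqP.
rewrite mulf_eq0 (negbTE sN) /= => /eqP sd0.
(* At a point of {D = 0}, [sigma] reproduces the coordinates of [v], so substituting before
   evaluating changes nothing. *)
have svd (q : P) : meval v (mmap (@mpolyC 7 C) sigma q) = meval v q.
  elim/mpolyind: q => [|a m q _ _ IH]; first by rewrite mmap0 !meval0.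
  rewrite mmapD !mevalD IH mmapZ mmapX mul_mpolyC !mevalZ; congr (_ * _ + _).
  rewrite /mmap1 mevalX rmorph_prod; apply: eq_bigr => k _.
  by rewrite rmorphXn /= (sv vD0).
by move: dv; rewrite -svd sd0 meval0 eqxx.
Qed.

Lemma meval_num0 v k : meval v (num0 X k) = num0 v k.
Proof.
by rewrite -[RHS](congr1 (fun e : 'I_7 -> C => num0 e k) (mevalXv v));
  exact: (rmorph_num0 (meval v)).
Qed.

Lemma meval_num1 v k : meval v (num1 X k) = num1 v k.
Proof.
by rewrite -[RHS](congr1 (fun e : 'I_7 -> C => num1 e k) (mevalXv v));
  exact: (rmorph_num1 (meval v)).
Qed.

Lemma meval_num2 v k : meval v (num2 X k) = num2 v k.
Proof.
by rewrite -[RHS](congr1 (fun e : 'I_7 -> C => num2 e k) (mevalXv v));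
  exact: (rmorph_num2 (meval v)).
Qed.

Lemma meval_den0 v : meval v (den0 X) = den0 v.
Proof.
by rewrite -[RHS](congr1 (@den0 C) (mevalXv v));
  exact: (rmorph_den0 (meval v)).
Qed.

Lemma meval_den1 v : meval v (den1 X) = den1 v.
Proof.
by rewrite -[RHS](congr1 (@den1 C) (mevalXv v));
  exact: (rmorph_den1 (meval v)).
Qed.

Lemma meval_f2 v : meval v (f2_of X) = f2_of v.
Proof.
by rewrite -[RHS](congr1 (@f2_of C) (mevalXv v));
  exact: (rmorph_f2 (meval v)).
Qed.

Lemma meval_den2 v : meval v (den2 X) = den2 v.
Proof.
by rewrite -[RHS](congr1 (@den2 C) (mevalXv v));
  exact: (rmorph_den2 (meval v)).
Qed.

Lemma s0_value k v c : den0 v != 0 -> has_value (s0 (rvar C k)) v c ->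
  c = img0 v k.
Proof.
rewrite s0_rvar img0_rvarE => d0 /(has_value_div (denX0 C)).
by rewrite meval_num0 meval_den0 img0E // => <-; rewrite mulfK.
Qed.

Lemma s1_value k v c : den1 v != 0 -> has_value (s1 (rvar C k)) v c ->
  c = img1 v k.
Proof.
rewrite s1_rvar img1_rvarE => d0 /(has_value_div (denX1 C)).
by rewrite meval_num1 meval_den1 img1E // => <-; rewrite mulfK.
Qed.

Lemma s2_value k v c : f2_of v != 0 -> has_value (s2 (rvar C k)) v c ->
  c = img2 v k.
Proof.
rewrite s2_rvar img2_rvarE => d0 /(has_value_div (denX2 C)).
by rewrite meval_num2 meval_den2 img2E // => <-; rewrite mulfK // expf_neq0.
Qed.

Lemma polyC_X (sigma : 'I_7 -> P) : mmap (@mpolyC 7 C) sigma \o X = sigma.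
Proof. by apply/funext => k /=; rewrite mmapX mmap1U. Qed.

(** On {w = 0} the numerator of the image of z is [a0_of]. The parameters being variables of the
    field, this is a nonzero polynomial, and the pole persists even at points where its value is
    zero. *)
Lemma s0_regular v c : has_value (s0 (rz C)) v c -> den0 v != 0.
Proof.
rewrite s0_rvar img0_rvarE => H; rewrite -meval_den0; move: H.
pose sigma (k : 'I_7) : P := if k == o 3 then 0 else X k.
apply: (@has_value_pole _ _ sigma); first exact: denX0.
- by rewrite /den0 mmapX mmap1U.
- apply: (@poly_eval_neq0 _ (fun=> 0)).
  rewrite (rmorph_num0 (mmap (@mpolyC 7 C) sigma)) polyC_X.
  rewrite (rmorph_num0 (meval (fun=> 0))) /num0; vars7.
  rewrite /a0_of /= /sigma /= meval0 !mevalXU.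
  by rewrite !(mulr0, subr0, add0r) oner_neq0.
- rewrite meval_den0 /den0 => v3 k; rewrite /sigma; case: eqP => [->|_].
    by rewrite meval0 v3.
  by rewrite mevalXU.
Qed.

Lemma s1_regular v c : has_value (s1 (ry C)) v c -> den1 v != 0.
Proof.
rewrite s1_rvar img1_rvarE => H; rewrite -meval_den1; move: H.
(* The equation [den1 = 0] is solved for x; the numerator of the image of y reduces there to minus
   alpha_1. *)
pose sigma (k : 'I_7) : P := if k == o 0 then - X (o 2) ^+ 2 else X k.
have den_s : den1 sigma = 0 by rewrite /den1 /sigma /= addNr.
apply: (@has_value_pole _ _ sigma); first exact: denX1.
- by rewrite (rmorph_den1 (mmap (@mpolyC 7 C) sigma)) polyC_X.
- apply: (@poly_eval_neq0 _ (fun=> 1)).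
  rewrite (rmorph_num1 (mmap (@mpolyC 7 C) sigma)) polyC_X.
  rewrite /num1; vars7; rewrite den_s mulr0 sub0r /sigma /= mevalN mevalXU.
  by rewrite oppr_eq0 oner_neq0.
- rewrite meval_den1 /den1 => v0 k; rewrite /sigma; case: eqP => [->|_].
    by rewrite mevalN rmorphXn /= mevalXU; apply/esym/eqP; rewrite -addr_eq0 v0.
  by rewrite mevalXU.
Qed.

Lemma s2_regular v c : has_value (s2 (ry C)) v c -> f2_of v != 0.
Proof.
(* Over [den2] the numerator would also vanish on the hypersurface, so one factor [f2_of] is
   cancelled first. *)
have -> : s2 (ry C) = F (X (o 1) * f2_of X - X (o 6)) / F (f2_of X).
  rewrite s2_rvar /img2; vars7.
  by rewrite tofracB tofracM mulrBl rmorph_f2 mulfK // f2_rvar.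
move=> H; rewrite -meval_f2; move: H.
pose sigma (k : 'I_7) : P :=
  if k == o 3 then - (X (o 0) + X (o 1) ^+ 2 + X (o 4)) else X k.
have f2_s : f2_of sigma = 0 by rewrite /f2_of /sigma /=; ring.
apply: (@has_value_pole _ _ sigma); first exact: f2X.
- by rewrite (rmorph_f2 (mmap (@mpolyC 7 C) sigma)) polyC_X.
- apply: (@poly_eval_neq0 _ (fun=> 1)).
  rewrite mmapB rmorphM (rmorph_f2 (mmap (@mpolyC 7 C) sigma)) polyC_X f2_s
    mulr0 sub0r.
  by rewrite mmapX mmap1U mevalN /sigma /= mevalXU oppr_eq0 oner_neq0.
- rewrite meval_f2 /f2_of => v0 k; rewrite /sigma; case: eqP => [->|_].
    rewrite mevalN !mevalD rmorphXn /= !mevalXU; apply/esym/eqP.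
    by rewrite -addr_eq0 -v0; apply/eqP; ring.
  by rewrite mevalXU.
Qed.
End Values.

(** * Transformation of solutions *)

Section Derivatives.
Variable C : numFieldType.
Implicit Types (f g : C -> C) (t c : C).

Definition has_deriv f t c := is_derive (t : C^o) 1 (f : C^o -> C^o) c.

Lemma has_deriv_cst a t : has_deriv (fun=> a) t 0.
Proof. exact: is_derive_cst. Qed.

Lemma has_deriv_id t : has_deriv (fun s => s) t 1.
Proof. exact: is_derive_id. Qed.

Lemma has_derivD f g t a b :
  has_deriv f t a -> has_deriv g t b ->
    has_deriv (fun s => f s + g s) t (a + b).
Proof. exact: is_deriveD. Qed.

Lemma has_derivB f g t a b :
  has_deriv f t a -> has_deriv g t b ->
    has_deriv (fun s => f s - g s) t (a - b).
Proof. exact: is_deriveB. Qed.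

Lemma has_derivM f g t a b :
  has_deriv f t a -> has_deriv g t b ->
  has_deriv (fun s => f s * g s) t (f t * b + g t * a).
Proof. exact: is_deriveM. Qed.

Lemma has_derivV f t a : f t != 0 -> has_deriv f t a ->
  has_deriv (fun s => (f s)^-1) t (- a / f t ^+ 2).
Proof.
move=> ft0 [df <-]; apply: DeriveDef; first exact: derivableV.
by rewrite deriveV // [LHS]mulNr mulNr mulrC.
Qed.

(** The explicit formulas are known only on [U]; openness gives agreement near [t], which is what a
    derivative sees. *)
Lemma has_deriv_eq_on (U : set C) f g t a : open (U : set C^o) -> U t ->
  (forall s, U s -> g s = f s) -> has_deriv f t a -> has_deriv g t a.
Proof.
move=> oU Ut fg; apply: near_eq_is_derive.
have : nbhs (t : C^o) U by exact: open_nbhs_nbhs.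
by apply: filterS => s /fg ->.
Qed.

Lemma mderiv_var (i j : 'I_5) : mderiv i (mpolyX C (mnm1 j)) = (j == i)%:R.
Proof.
rewrite mderivX mnm1E; case: eqP => [<-|_]; last by rewrite scale0r.
by rewrite scale1r (_ : mnm_sub _ _ = mnm0) ?mpolyX0 //; apply/mnmP => k;
  rewrite mnmBE subnn mnm0E.
Qed.

Lemma mderiv_sqr i (p : mpoly 5 C) : mderiv i (p ^+ 2) = p * mderiv i p *+ 2.
Proof. by rewrite mderivM mulrC mulr2n. Qed.

Lemma hamiltonian_partials (a : params C) (x y z w t : C) :
  let v := tnth [tuple x; y; z; w; t] in
  [/\ meval v (mderiv iy (hamiltonian a)) =
    4 * x * y - 2 * alpha1 a + 2 * z * w,
      meval v (mderiv ix (hamiltonian a)) = 2 * y ^+ 2 + 4 * x + 2 * t + w,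
      meval v (mderiv iw (hamiltonian a)) = z ^+ 2 - w + x + 2 * y * z &
      meval v (mderiv iz (hamiltonian a)) = 2 * z * w + alpha0 a + 2 * y * w].
Proof.
move=> v.
have vE : (v ix = x) * (v iy = y) * (v iz = z) * (v iw = w) * (v it = t) by [].
rewrite /hamiltonian; split;
  rewrite !mulr_natl ?(mderivD, mderivB, mderivN, mderivZ, mderivMn,
    mderiv_sqr, mderivM, mderiv_var) /=;
  rewrite ?(mevalD, mevalB, mevalN, mevalZ, mevalMn, rmorphXn, mevalM, meval1,
    meval0, mevalXU) /=;
  rewrite ?mevalXU !vE; by field.
Qed.

Lemma solvesP (a : params C) U x y z w :
  solves a U x y z w <-> forall t, U t ->
  [/\ has_deriv x t (4 * x t * y t - 2 * alpha1 a + 2 * z t * w t),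
      has_deriv y t (- (2 * y t ^+ 2 + 4 * x t + 2 * t + w t)),
      has_deriv z t (z t ^+ 2 - w t + x t + 2 * y t * z t) &
      has_deriv w t (- (2 * z t * w t + alpha0 a + 2 * y t * w t))].
Proof.
split=> S t Ut; case: (hamiltonian_partials a (x t) (y t) (z t) (w t) t) =>
  Ey Ex Ew Ez.
  case: (S t Ut) => dx dy dz dw.
  by split; [rewrite -Ey|rewrite -Ex|rewrite -Ew|rewrite -Ez].
by case: (S t Ut) => dx dy dz dw; split; rewrite ?(Ey, Ex, Ew, Ez).
Qed.

(** alpha_0 is not a coordinate of [point]; the normalization recovers it. *)
Lemma a0_point x y z w t (a : params C) :
  normalized a -> a0_of (Defs.point x y z w t a) = alpha0 a.
Proof.
move=> na; rewrite /a0_of /Defs.point; vars7.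
transitivity (alpha0 a + 2 * alpha1 a + 2 * alpha2 a
              - 2 * alpha1 a - 2 * alpha2 a).
  by rewrite na.
by ring.
Qed.

(** * Differentiating the transformed solutions *)

Section Solutions.
Variables (a : params C) (U : set C) (x y z w x' y' z' w' : C -> C).
Hypotheses (na : normalized a) (oU : open (U : set C^o))
  (Sa : solves a U x y z w).
Let pt t := Defs.point (x t) (y t) (z t) (w t) t a.
Definition transformed_by (s : ratfun C -> ratfun C) := forall t, U t ->
  [/\ has_value (s (rx C)) (pt t) (x' t), has_value (s (ry C)) (pt t) (y' t),
      has_value (s (rz C)) (pt t) (z' t) & has_value (s (rw C)) (pt t) (w' t)].

Let ode := iffLR (solvesP a U x y z w) Sa.

Lemma s0_solves : transformed_by (@s0 C) -> solves (p0 a) U x' y' z' w'.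
Proof.
move=> H.
(* A value of the new z at every time in [U] excludes zeros of w. *)
have w0 t : U t -> w t != 0 by move=> /H [_ _ /s0_regular].
have vals t : U t ->
    [/\ x' t = x t, y' t = y t, z' t = z t + alpha0 a / w t & w' t = w t].
  move=> Ut; have wt : den0 (pt t) != 0 by exact: w0.
  have [] := H t Ut; do 4!move=> /(s0_value wt) ->.
  by rewrite /img0; vars7; rewrite a0_point.
apply/solvesP => t Ut; have [-> -> -> ->] := vals t Ut.
have [dx dy dz dw] := ode Ut; have wt := w0 t Ut.
split.
- apply: (has_deriv_eq_on oU Ut (f := x)); first by move=> s /vals [].
  by apply: is_derive_eq dx _ => /=; field.
- apply: (has_deriv_eq_on oU Ut (f := y)); first by move=> s /vals [].
  by apply: is_derive_eq dy _.
- apply: (has_deriv_eq_on oU Ut (f := fun s => z s + alpha0 a * (w s)^-1)).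
    by move=> s /vals [].
  apply: is_derive_eq (has_derivD dz
    (has_derivM (has_deriv_cst _ t) (has_derivV wt dw))) _.
  by rewrite /=; field.
- apply: (has_deriv_eq_on oU Ut (f := w)); first by move=> s /vals [].
  by apply: is_derive_eq dw _ => /=; field.
Qed.

Lemma s1_solves : transformed_by (@s1 C) -> solves (p1 a) U x' y' z' w'.
Proof.
move=> H.
(* A product in place of a square, to match the shape of [has_derivM]. *)
pose g t := x t + z t * z t.
have g0 t : U t -> g t != 0 by move=> /H [_ /s1_regular].
have vals t : U t ->
    [/\ x' t = x t, y' t = y t - alpha1 a / g t, z' t = z t &
        w' t = w t - 2 * alpha1 a * (z t / g t)].
  move=> Ut; have gt : den1 (pt t) != 0 by exact: g0.
  have [] := H t Ut; do 4!move=> /(s1_value gt) ->.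
  by rewrite /img1; vars7; rewrite -mulrA.
apply/solvesP => t Ut; have [-> -> -> ->] := vals t Ut.
have [dx dy dz dw] := ode Ut; have gt := g0 t Ut.
have dV := has_derivV gt (has_derivD dx (has_derivM dz dz)).
split.
- apply: (has_deriv_eq_on oU Ut (f := x)); first by move=> s /vals [].
  by apply: is_derive_eq dx _; move: gt; rewrite /= /g => gt; field.
- apply: (has_deriv_eq_on oU Ut (f := fun s => y s - alpha1 a * (g s)^-1)).
    by move=> s /vals [].
  apply: is_derive_eq (has_derivB dy (has_derivM (has_deriv_cst _ t) dV)) _.
  by move: gt; rewrite /= /g => gt; field.
- apply: (has_deriv_eq_on oU Ut (f := z)); first by move=> s /vals [].
  by apply: is_derive_eq dz _; move: gt; rewrite /= /g => gt; field.
- apply: (has_deriv_eq_on oU Ut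
    (f := fun s => w s - 2 * alpha1 a * (z s * (g s)^-1))).
    by move=> s /vals [].
  apply: is_derive_eq (has_derivB dw
    (has_derivM (has_deriv_cst _ t) (has_derivM dz dV))) _.
  by move: gt; rewrite /= /g => gt; field.
Qed.

Lemma s2_solves : transformed_by (@s2 C) -> solves (p2 a) U x' y' z' w'.
Proof.
move=> H.
pose g t := x t + y t * y t + w t + t.
have g0 t : U t -> g t != 0 by move=> /H [_ /s2_regular].
have vals t : U t ->
    [/\ x' t = x t + 2 * alpha2 a * (y t / g t)
                - alpha2 a ^+ 2 * ((g t)^-1 * (g t)^-1),
        y' t = y t - alpha2 a / g t, z' t = z t + alpha2 a / g t & w' t = w t].
  move=> Ut; have gt : f2_of (pt t) != 0 by exact: g0.
  have [] := H t Ut; do 4!move=> /(s2_value gt) ->.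
  rewrite /img2; vars7; rewrite -mulrA -/(f2_of _) -[f2_of _]/(g t); split=> //.
  by rewrite -invfM.
apply/solvesP => t Ut; have [-> -> -> ->] := vals t Ut.
have [dx dy dz dw] := ode Ut; have gt := g0 t Ut.
(* The derivative 1 of the explicit t in f_2 is written through the normalization, so that the
   identities below hold for free parameters and [field] can prove them. *)
have dt : has_deriv (fun s => s) t (alpha0 a + 2 * alpha1 a + 2 * alpha2 a).
  by rewrite na; exact: has_deriv_id.
have dV := has_derivV gt (has_derivD (has_derivD
  (has_derivD dx (has_derivM dy dy)) dw) dt).
have dc c := has_deriv_cst c t.
split.
- apply: (has_deriv_eq_on oU Ut (f := fun s =>
    x s + 2 * alpha2 a * (y s * (g s)^-1)
    - alpha2 a ^+ 2 * ((g s)^-1 * (g s)^-1))); first by move=> s /vals [].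
  apply: is_derive_eq (has_derivB (has_derivD dx
    (has_derivM (dc _) (has_derivM dy dV)))
    (has_derivM (dc _) (has_derivM dV dV))) _.
  by move: gt; rewrite /= /g => gt; field.
- apply: (has_deriv_eq_on oU Ut (f := fun s => y s - alpha2 a * (g s)^-1)).
    by move=> s /vals [].
  apply: is_derive_eq (has_derivB dy (has_derivM (dc _) dV)) _.
  by move: gt; rewrite /= /g => gt; field.
- apply: (has_deriv_eq_on oU Ut (f := fun s => z s + alpha2 a * (g s)^-1)).
    by move=> s /vals [].
  apply: is_derive_eq (has_derivD dz (has_derivM (dc _) dV)) _.
  by move: gt; rewrite /= /g => gt; field.
- apply: (has_deriv_eq_on oU Ut (f := w)); first by move=> s /vals [].
  by apply: is_derive_eq dw _; move: gt; rewrite /= /g => gt; field.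
Qed.
End Solutions.

(** * Action on the parameters *)

Section Backlund.
Local Notation K := (ratfun C).
Local Notation P := (mpoly 7 C).
Local Notation F := (@tofrac P).
Local Notation X := (fun k : 'I_7 => mpolyX C (mnm1 k)).
Variables (a : params C) (x y z w t : C).
Hypothesis na : normalized a.
Let v := Defs.point x y z w t a.

(** The images of the parameters are polynomials, hence regular at every point. *)
Lemma has_value_poly (r : K) (p : P) c : r = F p -> c = meval v p ->
  has_value r v c.
Proof. by move=> -> ->; exact: has_value_tofrac. Qed.

Lemma meval_a0 : meval v (a0_of X) = alpha0 a.
Proof.
rewrite -[RHS](a0_point x y z w t na) -[RHS](congr1 (@a0_of C) (mevalXv v)).
exact: (rmorph_a0 (meval v)).
Qed.

Lemma s0_params :
  [/\ has_value (s0 (ra0 C)) v (alpha0 (p0 a)),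
    has_value (s0 (ra1 C)) v (alpha1 (p0 a)) &
      has_value (s0 (ra2 C)) v (alpha2 (p0 a))].
Proof.
have FE : a0_of (@rvar C) = F (a0_of X) by rewrite rmorph_a0.
split.
- apply: (@has_value_poly _ (- a0_of X)).
    by rewrite -[ra0 C]/(a0_of (@rvar C)) s0_a0 FE tofracN.
  by rewrite mevalN meval_a0.
- apply: (@has_value_poly _ (X (o 5) + a0_of X)).
    by rewrite tofracD -FE; exact: s0_rvar.
  by rewrite mevalD meval_a0 mevalXU.
- apply: (@has_value_poly _ (X (o 6))); first exact: s0_rvar.
  by rewrite mevalXU.
Qed.

Lemma s1_params :
  [/\ has_value (s1 (ra0 C)) v (alpha0 (p1 a)),
    has_value (s1 (ra1 C)) v (alpha1 (p1 a)) &
      has_value (s1 (ra2 C)) v (alpha2 (p1 a))].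
Proof.
have FE : a0_of (@rvar C) = F (a0_of X) by rewrite rmorph_a0.
split.
- apply: (@has_value_poly _ (a0_of X + 2 * X (o 5))).
    by rewrite -[ra0 C]/(a0_of (@rvar C)) s1_a0 FE [RHS]tofracD tofracM
      [F 2]rmorph_nat.
  by rewrite mevalD meval_a0 mevalM mevalXU [meval v 2]rmorph_nat.
- apply: (@has_value_poly _ (- X (o 5))).
    by rewrite tofracN; exact: s1_rvar.
  by rewrite mevalN mevalXU.
- apply: (@has_value_poly _ (X (o 6) + X (o 5))).
    by rewrite tofracD; exact: s1_rvar.
  by rewrite mevalD !mevalXU.
Qed.

Lemma s2_params :
  [/\ has_value (s2 (ra0 C)) v (alpha0 (p2 a)),
    has_value (s2 (ra1 C)) v (alpha1 (p2 a)) &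
      has_value (s2 (ra2 C)) v (alpha2 (p2 a))].
Proof.
have FE : a0_of (@rvar C) = F (a0_of X) by rewrite rmorph_a0.
split.
- apply: (@has_value_poly _ (a0_of X)); last by rewrite meval_a0.
  by rewrite -[ra0 C]/(a0_of (@rvar C)) s2_a0 FE.
- apply: (@has_value_poly _ (X (o 5) + 2 * X (o 6))).
    by rewrite tofracD tofracM [F 2]rmorph_nat; exact: s2_rvar.
  by rewrite mevalD mevalM !mevalXU [meval v 2]rmorph_nat.
- apply: (@has_value_poly _ (- X (o 6))).
    by rewrite tofracN; exact: s2_rvar.
  by rewrite mevalN mevalXU.
Qed.
End Backlund.

Lemma s0_backlund : is_backlund (@s0 C) (@p0 C).
Proof.
split.
- exact: (rmorphB (@s0 C)).
- by split; [exact: (rmorph1 (@s0 C)) | exact: (rmorphM (@s0 C))].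
- by exists (@s0 C); exact: s0K.
- exact: s0_rconst.
- exact: s0_rvar.
- by move=> a na; rewrite /normalized -[RHS]na /=; ring.
- by move=> a x y z w t na v; exact: s0_params.
- by move=> a U x y z w x' y' z' w' na oU Sa H; exact: (s0_solves na oU Sa H).
Qed.

Lemma s1_backlund : is_backlund (@s1 C) (@p1 C).
Proof.
split.
- exact: (rmorphB (@s1 C)).
- by split; [exact: (rmorph1 (@s1 C)) | exact: (rmorphM (@s1 C))].
- by exists (@s1 C); exact: s1K.
- exact: s1_rconst.
- exact: s1_rvar.
- by move=> a na; rewrite /normalized -[RHS]na /=; ring.
- by move=> a x y z w t na v; exact: s1_params.
- by move=> a U x y z w x' y' z' w' na oU Sa H; exact: (s1_solves oU Sa H).
Qed.

Lemma s2_backlund : is_backlund (@s2 C) (@p2 C).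
Proof.
split.
- exact: (rmorphB (@s2 C)).
- by split; [exact: (rmorph1 (@s2 C)) | exact: (rmorphM (@s2 C))].
- by exists (@s2 C); exact: s2K.
- exact: s2_rconst.
- exact: s2_rvar.
- by move=> a na; rewrite /normalized -[RHS]na /=; ring.
- by move=> a x y z w t na v; exact: s2_params.
- by move=> a U x y z w x' y' z' w' na oU Sa H; exact: (s2_solves na oU Sa H).
Qed.
End Derivatives.

Theorem theorem2p1 (R : realType) :
  let C : numFieldType := R[i] in
  [/\ is_backlund (@s0 C) (@p0 C),
      is_backlund (@s1 C) (@p1 C),
      is_backlund (@s2 C) (@p2 C) &
      weyl_A42_relations (@s0 C) (@s1 C) (@s2 C)].
Proof.
move=> C; split.
- exact: s0_backlund.
- exact: s1_backlund.
- exact: s2_backlund.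
- exact: weyl_relations.
Qed.
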